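(* There exists $n_0$ such that for every integer $n \ge n_0$ the following holds: if $G$ is a connected graph on $n$ vertices whose principal ratio $\gamma(G)$ is largest among all connected graphs on $n$ vertices, then $G$ is a kite graph, i.e. $G$ is isomorphic to $P_r \cdot K_s$ for some positive integers $r, s$ with $r+s-1=n$.
   Context: All graphs are finite, simple and undirected; eigenvalues and eigenvectors of a graph are those of its adjacency matrix. For a connected graph $G$, the principal eigenvector $\mathbf{x}$ is the eigenvector for the largest eigenvalue $\lambda_1(G)$, taken with all entries positive. If $x_{\min}$ and $x_{\max}$ are its smallest and largest entries, the principal ratio of $G$ is $\gamma(G) = x_{\max}/x_{\min}$. The graph $P_r \cdot K_s$ (a kite graph) is obtained by identifying an end vertex of a path on $r$ vertices with any one vertex of a complete graph on $s$ vertices. *)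

(* Defs.v *)
From HB Require Import structures.
From mathcomp Require Import all_boot all_order all_algebra.
From mathcomp Require Import boolp classical_sets reals.

Set Implicit Arguments.
Unset Strict Implicit.
Unset Printing Implicit Defensive.

Import Order.TTheory GRing.Theory Num.Theory.
Local Open Scope ring_scope.
Local Open Scope classical_set_scope.

Definition simple_graph (T : finType) (e : rel T) : Prop :=
  symmetric e /\ irreflexive e.

Definition connected_graph (T : finType) (e : rel T) : Prop :=
  forall x y : T, connect e x y.

Definition graph_isomorphic (T U : finType) (e : rel T) (f : rel U) : Prop :=
  exists2 h : T -> U, bijective h & forall x y : T, e x y = f (h x) (h y).

(* P_r . K_s: the path is 0 - 1 - ... - (r-1), the clique is on the s vertices
   r-1, ..., r+s-2, and r-1 is the identified vertex. Meant for 0 < r, 0 < s. *)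
Definition kite (r s : nat) : rel 'I_(r + s - 1)%N :=
  fun i j =>
    [&& (i < r)%N, (j < r)%N & (i.+1 == j :> nat) || (j.+1 == i :> nat)]
    || [&& (r - 1 <= i)%N, (r - 1 <= j)%N & i != j].
Arguments kite r s _ _ : clear implicits.

Definition adjacency_mx (R : realType) (n : nat) (e : rel 'I_n) : 'M[R]_n :=
  \matrix_(i, j) (e i j)%:R.

Definition largest_eigenvalue (R : realType) (n : nat) (A : 'M[R]_n) (l : R) :
    Prop :=
  eigenvalue A l /\ forall m : R, eigenvalue A m -> m <= l.

(* Row eigenvectors, as in the library; adjacency matrices are symmetric. *)
Definition is_principal_eigenvector (R : realType) (n : nat) (e : rel 'I_n)
    (x : 'rV[R]_n) : Prop :=
  (forall i : 'I_n, 0 < x 0 i) /\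
  exists2 l : R, largest_eigenvalue (adjacency_mx R e) l
               & x *m adjacency_mx R e = l *: x.

(* For a connected graph such a vector exists and is unique up to a positive
   factor, which does not affect principal_ratio; the default 0 is then
   irrelevant. *)
Definition principal_eigenvector (R : realType) (n : nat) (e : rel 'I_n) :
    'rV[R]_n :=
  xget 0 [set x | is_principal_eigenvector e x].

(* Largest entry of a vector with positive entries. *)
Definition entry_max (R : realType) (n : nat) (x : 'rV[R]_n) : R :=
  \big[Num.max/0]_(i < n) x 0 i.

(* Smallest entry when 0 < n: the initial value entry_max x bounds every entry
   from above. *)
Definition entry_min (R : realType) (n : nat) (x : 'rV[R]_n) : R :=
  \big[Num.min/entry_max x]_(i < n) x 0 i.

Definition principal_ratio (R : realType) (n : nat) (e : rel 'I_n) : R :=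
  entry_max (principal_eigenvector R e) / entry_min (principal_eigenvector R e).

(* Main.v *)
Require Import Defs.
From HB Require Import structures.
From mathcomp Require Import all_boot all_order all_algebra.
From mathcomp Require Import boolp classical_sets reals.
From mathcomp Require Import zify ring lra.

Import Order.TTheory GRing.Theory Num.Theory.
Local Open Scope ring_scope.

(** Write U_j(l) for the polynomials with U_0 = 0, U_1 = 1 and
    U_(j+2) = l U_(j+1) - U_j.  Along a path that leaves a pendant vertex, the
    entries of an eigenvector for l are proportional to U_1(l), U_2(l), ...;
    so the kite with r path vertices, a clique on M + 1 vertices and largest
    eigenvalue k has ratio at least U_r(k), and k > M.  These kites are the
    only competitors used ([kite_principal_ratio]).

    Let G be extremal, l its largest eigenvalue, x its principal eigenvector,
    and v_0, ..., v_D a shortest path from a vertex with the smallest entry to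
    one with the largest; let m be the number of the other vertices.  Since an
    entry x(v_(i+1)) is at most l x(v_i) - x(v_(i-1)), the ratio of G is at
    most U_(D+1)(l) ([path_cheb_bound]).  The eigenvalue equation at v_D, whose
    only neighbour on the path is v_(D-1), gives
    (l - m) x(v_D) <= x(v_(D-1)) ([end_vertex_bound]), in particular l <= m + 1.

    - Comparison with kites of other clique sizes shows that m and D / m exceed
      any given constant once n is large ([long_path_large_rest]).
    - Comparison with the kite on D + 1 path vertices, of eigenvalue k > m,
      gives l >= k, because U_(D+1) is increasing.
    - Put t = l - m, so that 0 < t <= 1 and the ratio of G is also at most
      U_D(l) / t.  The kite with one path vertex fewer has ratio more than
      U_D(m + 1), and U_D(m + t) <= t U_D(m + 1) unless t is at most about
      m / (16 D) ([cheb_large_shift]).  So t is that small, and then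
      U_(D+1)(m + t) < (3/2) U_(D+1)(m) ([cheb_small_shift]): the ratio of G is
      more than two thirds of its upper bound U_(D+1)(l).
    - This leaves no room for an edge from v_i with i < D to a vertex c off the
      path: since l > m, the equation at v_D forces x(c) > x(v_D) / 2, and such
      a neighbour would cost a factor of at least 3/2 on the way along the path
      ([off_path_at_end]).

    Hence G is, up to relabelling, a spanning subgraph of the kite on D + 1
    path vertices ([kite_relabel]).  As l >= k, strict monotonicity of the
    largest eigenvalue under adding edges to a graph with a positive
    eigenvector ([subgraph_eigenvalue]) makes the two graphs equal.

    Perron-Frobenius theory enters only in the easy direction (a positive
    eigenvector belongs to the largest eigenvalue): the kites have explicit
    positive eigenvectors, and G has one because otherwise its ratio would be
    the junk value 0. *)

(** * Growth of exponentials and Chebyshev polynomials *)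

(** The hypothesis compares the upper bound (m+1)^D for the ratio of an
    extremal graph with the lower bounds d^r for kites, where n = m + D + 1.
    If m is bounded, d = (m+2)^2 beats it, because it costs only boundedly
    many steps of the path.  If D < L (m+1), shrinking the base from m to
    d = m / 3 loses 4^D but gains d^d. *)
Lemma long_path_large_rest (L : nat) : exists n0 : nat, forall m D : nat,
  (n0 <= m + D)%N ->
  (forall d r, (d + r).+1 = (m + D)%N -> (0 < d)%N -> (0 < r)%N ->
     (d ^ r <= m.+1 ^ D)%N) ->
  (L <= m)%N /\ (L * m.+1 <= D)%N.
Proof.
pose m0 := (3 * 4 ^ (4 * L) + 20 + L)%N.
exists (2 * (m0 + 2) ^ 2 + m0 + 10)%N => m D n_ge race.
have m_ge : (m0 <= m)%N.
  rewrite leqNgt; apply/negP => m_lt.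
  have d_le : ((m + 2) ^ 2 <= (m0 + 2) ^ 2)%N by rewrite leq_exp2r //; lia.
  have d_gt0 : (0 < (m + 2) ^ 2)%N by rewrite expn_gt0; lia.
  move: n_ge race d_le d_gt0.
  set a := (_ ^ 2)%N; set b := (_ ^ 2)%N => n_ge race d_le d_gt0.
  have := race b (m + D - 1 - b)%N ltac:(lia) d_gt0 ltac:(lia).
  rewrite leqNgt => /negP; apply.
  rewrite /b -expnM; apply: (@leq_trans ((m + 2) ^ D)).
    by rewrite ltn_exp2r; lia.
  by rewrite leq_exp2l; lia.
split; first by rewrite /m0 in m_ge; lia.
rewrite leqNgt; apply/negP => D_lt.
pose d := (m %/ 3)%N.
have := divn_eq m 3; have := ltn_pmod m (isT : (0 < 3)%N).
rewrite -/d; set q := (m %% 3)%N => q_lt m_eq.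
(* 4^(4L) <= d is what turns D < L (m+1) <= 4 L d into 4^D < d^d. *)
have d_ge : (4 ^ (4 * L) <= d)%N by rewrite /m0 in m_ge; lia.
have d6 : (6 <= d)%N.
  by move: m_ge; rewrite /m0; lia.
have := race d (D + (m - 1 - d))%N ltac:(lia) ltac:(lia) ltac:(lia).
rewrite leqNgt => /negP; apply.
apply: (@leq_ltn_trans ((4 * d) ^ D)).
  by case: (D) => [//|D']; rewrite leq_exp2r //; lia.
rewrite expnMn expnD mulnC ltn_pmul2l ?expn_gt0 ?(leq_trans _ d6) //.
apply: (@leq_trans (d ^ d)); last by rewrite leq_exp2l; lia.
apply: (@leq_trans ((4 ^ (4 * L)) ^ d)).
  rewrite -expnM ltn_exp2l //; nia.
by rewrite leq_exp2r //; lia.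
Qed.

(** This is U_j(a) as above, the Chebyshev polynomial of the second kind of degree
    j - 1 taken at a / 2.  The ring is arbitrary so that the same recursion, taken at ['X],
    is available as a polynomial. *)
Fixpoint cheb {A : pzRingType} (a : A) (j : nat) : A :=
  match j with
  | 0 => 0
  | j'.+1 => match j' with 0 => 1 | j''.+1 => a * cheb a j' - cheb a j'' end
  end.
Arguments cheb {A} a j : simpl never.

Section ChebAlg.
Context {A : pzRingType} (a : A).
Lemma cheb0 : cheb a 0 = 0. Proof. by []. Qed.
Lemma cheb1 : cheb a 1 = 1. Proof. by []. Qed.
Lemma chebSS j : cheb a j.+2 = a * cheb a j.+1 - cheb a j. Proof. by []. Qed.
End ChebAlg.

Section Cheb.
Context {R : realType}.
Implicit Types (a b : R).

Lemma horner_cheb a j : (cheb 'X j).[a] = cheb a j.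
Proof.
suff : (cheb 'X j).[a] = cheb a j /\ (cheb 'X j.+1).[a] = cheb a j.+1 by case.
elim: j => [|j [IH0 IH1]]; first by rewrite cheb0 !cheb1 !hornerE.
by split=> //; rewrite !chebSS !hornerE IH0 IH1.
Qed.

Lemma cheb_step a j : 2 <= a ->
  0 <= cheb a j /\ (cheb a j <= cheb a j.+1 /\ 0 < cheb a j.+1).
Proof.
move=> a2; elim: j => [|j [IH0 [IH1 IH2]]].
  by rewrite cheb0 cheb1 ler01 ltr01 lexx.
rewrite chebSS; nra.
Qed.

Lemma cheb_ge0 a j : 2 <= a -> 0 <= cheb a j.
Proof. by move=> /(cheb_step a j)[]. Qed.

Lemma cheb_gt0 a j : 2 <= a -> 0 < cheb a j.+1.
Proof. by move=> /(cheb_step a j)[_ []]. Qed.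

Lemma cheb_nondec a j : 2 <= a -> cheb a j <= cheb a j.+1.
Proof. by move=> /(cheb_step a j)[_ []]. Qed.

Lemma cheb_ratio_ge a j : 2 <= a -> (a - 1) * cheb a j <= cheb a j.+1.
Proof.
move=> a2; case: j => [|j]; first by rewrite cheb0 cheb1 mulr0 ler01.
by rewrite chebSS; have := cheb_nondec a j a2; nra.
Qed.

Lemma cheb_geX a j : 2 <= a -> (a - 1) ^+ j <= cheb a j.+1.
Proof.
move=> a2; elim: j => [|j IH]; first by rewrite expr0 cheb1.
rewrite exprS; apply: le_trans (cheb_ratio_ge a j.+1 a2).
by rewrite ler_wpM2l //; lra.
Qed.

(** By induction, as U_(j+1)(a) / (a U_j(a)) = 1 - U_(j-1)(a) / (a U_j(a))
    is nondecreasing in a. *)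
Lemma cheb_cross a b j : 2 <= a -> a <= b ->
  b * (cheb a j.+1 * cheb b j) <= a * (cheb b j.+1 * cheb a j).
Proof.
move=> a2 ab; have b2 : 2 <= b by exact: le_trans ab.
elim: j => [|j IH]; first by rewrite !cheb0 !mulr0.
rewrite !chebSS.
have := cheb_ge0 a j a2; have := cheb_gt0 b j b2.
move: IH; set ua := cheb a j; set ub := cheb b j.
set va := cheb a j.+1; set vb := cheb b j.+1 => IH vb0 ua0.
suff : a * (va * ub) <= b * (vb * ua) by nra.
have w0 : 0 <= vb * ua by nra.
move: IH w0; move: (va * ub) (vb * ua) => s t IH w0.
have : b * (a * s) <= b * (b * t).
  rewrite mulrCA; apply: (@le_trans _ _ (a * (a * t))).
    by apply: ler_wpM2l => //; lra.
  by rewrite !mulrA; apply: ler_wpM2r => //; apply: ler_pM => //; lra.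
by rewrite ler_pM2l // (lt_le_trans _ b2).
Qed.

(** Telescoping [cheb_cross]: U_(j+1)(a) / a^j is nondecreasing in a. *)
Lemma cheb_scale a b j : 2 <= a -> a <= b ->
  b ^+ j * cheb a j.+1 <= a ^+ j * cheb b j.+1.
Proof.
move=> a2 ab; have b2 : 2 <= b by exact: le_trans ab.
elim: j => [|j IH]; first by rewrite !cheb1 !expr0.
have := cheb_cross a b j.+1 a2 ab.
have ua0 := cheb_gt0 a j a2; have ub0 := cheb_gt0 b j b2.
have va0 := cheb_gt0 a j.+1 a2; have vb0 := cheb_gt0 b j.+1 b2.
rewrite !exprS => cross.
have aj0 : 0 < a ^+ j by rewrite exprn_gt0 //; lra.
have bj0 : 0 < b ^+ j by rewrite exprn_gt0 //; lra.
rewrite -(ler_pM2r ub0).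
apply: (@le_trans _ _ (b ^+ j * (a * (cheb b j.+2 * cheb a j.+1)))).
  by rewrite [leLHS](_ : _ = b ^+ j * (b * (cheb a j.+2 * cheb b j.+1))); [rewrite ler_pM2l | ring].
rewrite [leLHS](_ : _ = (a * cheb b j.+2) * (b ^+ j * cheb a j.+1)); last by ring.
rewrite [leRHS](_ : _ = (a * cheb b j.+2) * (a ^+ j * cheb b j.+1)); last by ring.
by rewrite ler_pM2l //; apply: mulr_gt0 => //; lra.
Qed.

Lemma cheb_le a b j : 2 <= a -> a <= b -> cheb a j <= cheb b j.
Proof.
move=> a2 ab; case: j => [|j]; first by rewrite !cheb0.
have aj0 : 0 < a ^+ j by rewrite exprn_gt0 //; lra.
rewrite -(ler_pM2l aj0); apply: le_trans (cheb_scale a b j a2 ab).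
rewrite ler_pM2r ?cheb_gt0 //; apply: lerXn2r; rewrite ?nnegrE; lra.
Qed.

Lemma cheb_lt a b j : 2 <= a -> a < b -> cheb a j.+2 < cheb b j.+2.
Proof.
move=> a2 ab; have aj0 : 0 < a ^+ j.+1 by rewrite exprn_gt0 //; lra.
rewrite -(ltr_pM2l aj0); apply: lt_le_trans (cheb_scale a b j.+1 a2 (ltW ab)).
rewrite ltr_pM2r ?cheb_gt0 //; apply: ltrXn2r; rewrite ?nnegrE //; lra.
Qed.

(** The ratio U_(j+1) / U_j has slope at most 2: its recursion
    q -> a - 1/q adds 1 to the slope and divides the old slope by q^2 >= 4. *)
Lemma cheb_cross_diff a b j : 3 <= a -> a <= b ->
  cheb b j.+1 * cheb a j - cheb a j.+1 * cheb b j
    <= 2 * (b - a) * (cheb a j * cheb b j).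
Proof.
move=> a3 ab.
elim: j => [|j IH]; first by rewrite !cheb0 !mulr0 subrr.
rewrite !chebSS.
have ha := cheb_ratio_ge a j ltac:(lra).
have hb := cheb_ratio_ge b j ltac:(lra).
have a0 := cheb_ge0 a j ltac:(lra); have b0 := cheb_ge0 b j ltac:(lra).
move: IH ha hb a0 b0; set ua := cheb a j; set ub := cheb b j.
set va := cheb a j.+1; set vb := cheb b j.+1 => IH ha hb a0 b0.
have ha2 : 2 * ua <= va by nra.
have hb2 : 2 * ub <= vb by nra.
have : 2 * (ua * ub) <= va * vb by nra.
set s := ua * ub; set t := va * vb => st.
rewrite -/s in IH.
have -> : (b * vb - ub) * va - (a * va - ua) * vb =
  (b - a) * t + (vb * ua - va * ub) by rewrite /t; ring.
nra.
Qed.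

(** By [cheb_cross_diff] each of the j ratios grows at most by the factor
    1 + z with z = 2 (b - a) / (a - 1), and (1 + z)^j (1 - j z) <= 1. *)
Lemma cheb_growth a b j : 3 <= a -> a <= b ->
  cheb b j.+1 * (1 - j%:R * (2 * (b - a) / (a - 1))) <= cheb a j.+1.
Proof.
move=> a3 ab; set z := _ / _.
have z0 : 0 <= z by rewrite divr_ge0 //; lra.
elim: j => [|j IH]; first by rewrite !cheb1 mul0r subr0 mulr1.
have ua0 := cheb_gt0 a j ltac:(lra); have ub0 := cheb_gt0 b j ltac:(lra).
have va0 := cheb_gt0 a j.+1 ltac:(lra); have vb0 := cheb_gt0 b j.+1 ltac:(lra).
have [neg|pos] := leP (1 - j.+1%:R * z) 0; first by nra.
have cross : cheb b j.+2 * cheb a j.+1 <= (1 + z) * (cheb a j.+2 * cheb b j.+1).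
  have := cheb_cross_diff a b j.+1 a3 ab.
  have ra := cheb_ratio_ge a j.+1 ltac:(lra).
  have zE : 2 * (b - a) = z * (a - 1) by rewrite /z; field; lra.
  rewrite zE.
  move: ra ub0 va0; set ua := cheb a j.+1; set ub := cheb b j.+1.
  set va := cheb a j.+2; set vb := cheb b j.+2 => ra ub0 va0 h.
  have : z * ub * ((a - 1) * ua) <= z * ub * va by apply: ler_wpM2l => //; nra.
  nra.
rewrite -(ler_pM2r ua0).
move: cross IH ua0 ub0 va0 vb0 pos; rewrite -natr1.
set ua := cheb a j.+1; set ub := cheb b j.+1.
set va := cheb a j.+2; set vb := cheb b j.+2; set J := j%:R : R.
have J0 : 0 <= J by rewrite /J.
clearbody ua ub va vb J z => cross IH ua0 ub0 va0 vb0 pos.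
set w := 1 - (J + 1) * z in pos *.
have h1 : w * (vb * ua) <= w * ((1 + z) * (va * ub)) by rewrite ler_pM2l.
have h2 : (w * (1 + z)) * (va * ub) <= (1 - J * z) * (va * ub).
  by apply: ler_wpM2r; [nra | rewrite /w; nra].
have h3 : va * (ub * (1 - J * z)) <= va * ua by rewrite ler_pM2l.
nra.
Qed.

End Cheb.

Lemma bernoulli2 {R : realType} (z : R) N : 0 <= z ->
  1 + N%:R * z + N%:R * (N%:R - 1) / 2 * z ^+ 2 <= (1 + z) ^+ N.
Proof.
move=> z0; elim: N => [|N IH]; first by rewrite !mul0r !addr0 expr0.
rewrite [(1 + z) ^+ _]exprS -natr1.
have : 0 <= N%:R * (N%:R - 1) :> R.
  by case: N {IH} => [|N]; rewrite ?mul0r // mulr_ge0 // -natr1 addrK.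
move: IH; set P := (1 + z) ^+ N; set n := N%:R => IH n0.
apply: (@le_trans _ _ ((1 + z) * (1 + n * z + n * (n - 1) / 2 * z ^+ 2)));
  last first. by rewrite ler_pM2l //; lra.
have : 0 <= n * (n - 1) * z ^+ 3 by rewrite mulr_ge0 // exprn_ge0.
have -> : (1 + z) * (1 + n * z + n * (n - 1) / 2 * z ^+ 2) =
  1 + (n + 1) * z + (n + 1) * (n + 1 - 1) / 2 * z ^+ 2 +
  n * (n - 1) * z ^+ 3 / 2 by field.
lra.
Qed.

(** By [cheb_scale] the claim reduces to t ((m+1)/(m+t))^N >= 1.  Writing
    (m+1)/(m+t) = 1 + z, the linear term N z of the binomial expansion suffices
    for t >= 1/2; below that, the quadratic term does. *)
Lemma cheb_large_shift {R : realType} (m N : nat) (t : R) :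
  (2 <= m)%N -> 256 * (m%:R + 1) <= N%:R :> R -> 0 < t -> t <= 1 ->
  m%:R + 1 <= 16 * N%:R * t ->
  cheb (m%:R + t) N.+1 <= t * cheb (m%:R + 1) N.+1.
Proof.
move=> m2 NLR t0 t1 tN.
have M2 : 2 <= m%:R :> R by rewrite (ler_nat _ 2).
move: tN NLR; set M := m%:R; set n := N%:R => tN NLR.
have mt0 : 0 < M + t by rewrite /M; lra.
have h := cheb_scale (M + t) (M + 1) N ltac:(rewrite /M; lra) ltac:(lra).
pose z := (1 - t) / (M + t).
have z0 : 0 <= z by rewrite divr_ge0 //; lra.
have zE : (M + t) * (1 + z) = M + 1 by rewrite /z; field; rewrite gt_eqF.
have zE' : (M + t) * z = 1 - t by rewrite /z; field; rewrite gt_eqF.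
suff big : 1 <= t * (1 + z) ^+ N.
  rewrite -zE exprMn in h.
  have p0 : 0 < (M + t) ^+ N by rewrite exprn_gt0.
  have c0 : 0 <= cheb (M + 1) N.+1 by apply/ltW/cheb_gt0; rewrite /M; lra.
  have h' : (1 + z) ^+ N * cheb (M + t) N.+1 <= cheb ((M + t) * (1 + z)) N.+1.
    by rewrite -(ler_pM2l p0) mulrA.
  rewrite -zE; apply: le_trans (ler_wpM2l (ltW t0) h').
  rewrite mulrA -{1}[cheb _ _]mul1r ler_wpM2r //.
  by apply/ltW/cheb_gt0; rewrite /M; lra.
apply: le_trans (ler_wpM2l (ltW t0) (bernoulli2 z N z0)).
rewrite -/n.
have n1 : 768 <= n by rewrite /M in NLR; lra.
have n2 : n * n / 4 <= n * (n - 1) / 2 by nra.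
have q : n * n / 4 * z ^+ 2 <= n * (n - 1) / 2 * z ^+ 2.
  by rewrite ler_wpM2r // exprn_ge0.
suff : 1 - t <= t * (n * z + n * n / 4 * z ^+ 2).
  have := ler_wpM2l (ltW t0) q; lra.
rewrite -zE'.
suff : M + t <= t * (n + n * n / 4 * z).
  move=> /(ler_wpM2r z0) s; apply: le_trans s _.
  by rewrite le_eqVlt; apply/orP; left; apply/eqP; ring.
have [t2|t2] := leP (1 / 2) t.
  have : 0 <= t * (n * n * z).
    by apply: mulr_ge0; [exact: ltW | apply: mulr_ge0 => //; apply: mulr_ge0].
  have : 1 / 2 * n <= t * n by rewrite ler_wpM2r //; lra.
  lra.
have zb : 1 <= z * (2 * (M + 1)).
  by rewrite /z mulrAC ler_pdivlMr //; nra.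
have tn0 : 0 < t * n by apply: mulr_gt0; lra.
have s1 : (M + 1) * (n * z) <= 16 * n * t * (n * z).
  by apply: ler_wpM2r => //; rewrite mulr_ge0 //; lra.
have s2 : n <= n * (z * (2 * (M + 1))) by rewrite ler_peMr //; lra.
lra.
Qed.

Lemma cheb_small_shift {R : realType} (m N : nat) (t : R) :
  (8 <= m)%N -> (0 < N)%N -> 0 <= t -> 16 * N%:R * t < m%:R + 1 ->
  2 * cheb (m%:R + t) N.+2 < 3 * cheb m%:R N.+2.
Proof.
move=> m8 N0 t0 tN.
have M8 : 8 <= m%:R :> R by rewrite (ler_nat _ 8).
have N1 : 1 <= N%:R :> R by rewrite (ler_nat _ 1).
have := cheb_growth m%:R (m%:R + t) N.+1 ltac:(lra) ltac:(lra).
have := cheb_gt0 (m%:R + t) N.+1 ltac:(lra).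
rewrite [m%:R + t - _]addrC addKr -natr1.
set n := N%:R in tN N1 *; set M := m%:R in tN M8 *.
set c := cheb (M + t) _ => c0 h.
have w : (n + 1) * (2 * t / (M - 1)) < 1 / 3.
  rewrite mulrA ltr_pdivrMr; last by lra.
  nra.
have : c * (2 / 3) < c * (1 - (n + 1) * (2 * t / (M - 1))).
  by rewrite ltr_pM2l //; lra.
lra.
Qed.

(** * Positive eigenvectors and the principal ratio *)

Definition eigenfun {R : realType} {T : finType} (e : rel T) (l : R)
    (x : T -> R) : Prop :=
  forall a, \sum_(b | e a b) x b = l * x a.

(** Pairing the two eigenvectors through both adjacency matrices.  It yields the
    uniqueness of the positive eigenvalue (for e = f) and the monotonicity
    under adding edges (for e included in f). *)
Lemma eigenfun_pairing {R : realType} {T : finType} (e f : rel T) (l k : R)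
    (x y : T -> R) :
  symmetric e -> eigenfun e l x -> eigenfun f k y ->
  \sum_a \sum_b ((f a b)%:R - (e a b)%:R) * (x a * y b)
    = (k - l) * \sum_a x a * y a.
Proof.
move=> e_sym xE yE.
have fE : \sum_a \sum_b (f a b)%:R * (x a * y b) = k * \sum_a x a * y a.
  rewrite mulr_sumr; apply: eq_bigr => a _.
  rewrite mulrCA -yE mulr_sumr [RHS]big_mkcond; apply: eq_bigr => b _.
  by case: (f a b); rewrite ?mul1r ?mul0r.
have eE : \sum_a \sum_b (e a b)%:R * (x a * y b) = l * \sum_a x a * y a.
  rewrite exchange_big mulr_sumr; apply: eq_bigr => b _.
  rewrite mulrA -xE mulr_suml [RHS]big_mkcond; apply: eq_bigr => a _.
  by rewrite e_sym; case: (e b a); rewrite ?mul1r ?mul0r.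
rewrite mulrBl -fE -eE -sumrB; apply: eq_bigr => a _.
by rewrite -sumrB; apply: eq_bigr => b _; rewrite mulrBl.
Qed.

Lemma pairing_gt0 {R : realType} {T : finType} (x y : T -> R) (a0 : T) :
  (forall a, 0 < x a) -> (forall a, 0 < y a) -> 0 < \sum_a x a * y a.
Proof.
move=> x0 y0; rewrite (bigD1 a0) //= ltr_wpDr ?mulr_gt0 //.
by apply: sumr_ge0 => a _; rewrite mulr_ge0 ?ltW.
Qed.

Lemma positive_eigenvalue_unique {R : realType} {T : finType} (e : rel T)
    (l k : R) (x y : T -> R) (a0 : T) :
  symmetric e -> (forall a, 0 < x a) -> (forall a, 0 < y a) ->
  eigenfun e l x -> eigenfun e k y -> l = k.
Proof.
move=> e_sym x0 y0 xE yE.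
have := eigenfun_pairing e e l k x y e_sym xE yE.
rewrite big1 => [/esym/eqP|a _]; last by rewrite big1 // => b _; rewrite subrr mul0r.
by rewrite mulf_eq0 (gt_eqF (pairing_gt0 x y a0 x0 y0)) orbF subr_eq0 => /eqP.
Qed.

(** In [eigenfun_pairing] all summands are nonnegative while the right-hand
    side is not positive, so every summand vanishes. *)
Lemma subgraph_eigenvalue {R : realType} {T : finType} (e f : rel T) (l k : R)
    (x y : T -> R) (a0 : T) :
  symmetric e -> (forall a, 0 < x a) -> (forall a, 0 < y a) ->
  eigenfun e l x -> eigenfun f k y ->
  subrel e f -> k <= l -> e =2 f.
Proof.
move=> e_sym x0 y0 xE yE sub kl.
have term0 a b : 0 <= ((f a b)%:R - (e a b)%:R) * (x a * y b).
  apply: mulr_ge0; last by apply: mulr_ge0; apply: ltW.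
  rewrite subr_ge0 ler_nat.
  by case: (e a b) (sub a b) => // ->.
have row0 a : 0 <= \sum_b ((f a b)%:R - (e a b)%:R) * (x a * y b).
  exact: sumr_ge0.
have sum_le0 : \sum_a \sum_b ((f a b)%:R - (e a b)%:R) * (x a * y b) <= 0.
  rewrite (eigenfun_pairing e f l k) // mulr_le0_ge0 ?subr_le0 //.
  exact/ltW/(pairing_gt0 x y a0).
have /eqP : \sum_a \sum_b ((f a b)%:R - (e a b)%:R) * (x a * y b) == 0.
  by rewrite eq_le sum_le0 sumr_ge0.
move=> sum0 a b.
have row_eq0 : \sum_b ((f a b)%:R - (e a b)%:R) * (x a * y b) = 0.
  exact: (psumr_eq0P (fun a _ => row0 a) sum0).
have /eqP : ((f a b)%:R - (e a b)%:R) * (x a * y b) = 0.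
  exact: (psumr_eq0P (fun b _ => term0 a b) row_eq0).
rewrite mulf_eq0 orbC gt_eqF ?mulr_gt0 //= subr_eq0 eqr_nat.
by case: (e a b) (f a b) => [] [].
Qed.

Lemma eigenfun_mx {R : realType} {n : nat} (e : rel 'I_n) (l : R) (x : 'rV[R]_n) :
  symmetric e ->
  (x *m adjacency_mx R e = l *: x <-> eigenfun e l (x 0)).
Proof.
move=> e_sym.
have mulE i : (x *m adjacency_mx R e) 0 i = \sum_(j | e i j) x 0 j.
  rewrite mxE [RHS]big_mkcond; apply: eq_bigr => j _.
  by rewrite mxE e_sym; case: (e i j); rewrite ?mulr1 ?mulr0.
split=> [xE i|xE]; first by rewrite -mulE xE mxE.
by apply/rowP => i; rewrite mulE xE mxE.
Qed.

(** Take absolute values in the eigenvalue equation of any other eigenvector and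
    pair with the positive one. *)
Lemma positive_eigenvalue_largest {R : realType} {n : nat} (e : rel 'I_n)
    (l : R) (x : 'I_n -> R) :
  symmetric e -> (forall i, 0 < x i) -> eigenfun e l x ->
  forall k, eigenvalue (adjacency_mx R e) k -> k <= l.
Proof.
move=> e_sym x0 xE k /eigenvalueP[v /(eigenfun_mx e k v e_sym) vE v_neq0].
have [a va] : exists a, v 0 a != 0 by apply/rV0Pn.
have pos : 0 < \sum_i x i * `|v 0 i|.
  rewrite (bigD1 a) //= ltr_wpDr ?mulr_gt0 ?normr_gt0 //.
  by apply: sumr_ge0 => i _; apply: mulr_ge0 => //; apply: ltW.
rewrite -(ler_pM2r pos) !mulr_sumr.
apply: (@le_trans _ _ (\sum_i \sum_(j | e i j) x i * `|v 0 j|)).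
  apply: ler_sum => i _; rewrite mulrCA -mulr_sumr ler_pM2l //.
  apply: le_trans (ler_norm_sum _ _ _); rewrite vE normrM.
  by rewrite ler_wpM2r // ler_norm.
rewrite (exchange_big_dep xpredT) //=; apply: ler_sum => j _.
rewrite mulrA -xE mulr_suml le_eqVlt; apply/orP; left; apply/eqP.
by apply: eq_bigl => i; rewrite e_sym.
Qed.

Lemma principal_eigenvector_spec {R : realType} {n : nat} (e : rel 'I_n)
    (l : R) (x : 'I_n -> R) (i0 : 'I_n) :
  symmetric e -> (forall i, 0 < x i) -> eigenfun e l x ->
  let z := principal_eigenvector R e in
  (forall i, 0 < z 0 i) /\ eigenfun e l (z 0).
Proof.
move=> e_sym x0 xE z.
have xrE : eigenfun e l ((\row_j x j) 0).
  by move=> i; rewrite mxE -xE; apply: eq_bigr => j _; rewrite mxE.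
have : is_principal_eigenvector e z.
  apply: (@xgetI _ 0 _ (\row_j x j)); split=> [i|]; first by rewrite mxE.
  exists l; last exact/eigenfun_mx.
  split; last by move=> k; apply: (positive_eigenvalue_largest e l x).
  apply/eigenvalueP; exists (\row_j x j); first exact/eigenfun_mx.
  by apply/rV0Pn; exists i0; rewrite mxE gt_eqF.
case=> z0 [k _ /(eigenfun_mx e k z e_sym) zE]; split=> //.
by rewrite (positive_eigenvalue_unique e l k x (z 0) i0).
Qed.

Lemma entry_max_ge {R : realType} {n : nat} (z : 'rV[R]_n) i : z 0 i <= entry_max z.
Proof. exact: (le_bigmax (0 : R) (z 0)). Qed.

Lemma entry_max_attained {R : realType} {n : nat} (z : 'rV[R]_n) (i0 : 'I_n) :
  (forall i, 0 < z 0 i) -> exists w, entry_max z = z 0 w.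
Proof.
move=> z0; have [|w _ wE] := @eq_bigmax _ R 'I_n 0 i0 xpredT (z 0) isT.
  by move=> i _; apply: ltW.
by exists w.
Qed.

Lemma entry_min_le {R : realType} {n : nat} (z : 'rV[R]_n) i : entry_min z <= z 0 i.
Proof. exact: (bigmin_le (entry_max z) i (z 0)). Qed.

Lemma entry_min_attained {R : realType} {n : nat} (z : 'rV[R]_n) (i0 : 'I_n) :
  exists u, entry_min z = z 0 u.
Proof.
have [|u _ uE] := @eq_bigmin _ R 'I_n (entry_max z) i0 xpredT (z 0) isT.
  by move=> i _; apply: entry_max_ge.
by exists u.
Qed.

Lemma ratio_le_principal_ratio {R : realType} {n : nat} (e : rel 'I_n) (i j : 'I_n) :
  let z := principal_eigenvector R e in
  (forall i, 0 < z 0 i) -> z 0 i / z 0 j <= principal_ratio R e.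
Proof.
move=> z z0; have [u uE] := entry_min_attained z i.
rewrite /principal_ratio -/z; apply: ler_pM => //.
- exact: ltW.
- by rewrite invr_ge0 ltW.
- exact: entry_max_ge.
rewrite lef_pV2 ?posrE //; first exact: entry_min_le.
by rewrite uE.
Qed.

(** Without a principal eigenvector the ratio is 0 / 0 = 0; this replaces the
    existence part of the Perron-Frobenius theorem. *)
Lemma positive_principal_ratio {R : realType} {n : nat} (e : rel 'I_n) (i0 : 'I_n) :
  symmetric e -> 0 < principal_ratio R e ->
  exists (l : R) (x : 'I_n -> R) (u w : 'I_n),
    [/\ forall i, 0 < x i, eigenfun e l x,
        forall i, x u <= x i, forall i, x i <= x w &
        principal_ratio R e = x w / x u].
Proof.
move=> e_sym; rewrite /principal_ratio; set z := principal_eigenvector R e.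
have [ex|nex] := pselect (exists x : 'rV[R]_n, is_principal_eigenvector e x); last first.
  have -> : z = 0 by apply: (@xgetPN _ 0 (is_principal_eigenvector e)) => x ?; apply: nex; exists x.
  have -> : entry_max (0 : 'rV[R]_n) = 0.
    by rewrite /entry_max; apply: bigmax_eq_id => i _; rewrite mxE.
  by rewrite mul0r ltxx.
have : is_principal_eigenvector e z by exact: (@xgetPex _ 0 (is_principal_eigenvector e) ex).
move=> [z0 [l _ lE]] _.
have [w wE] := entry_max_attained z i0 z0.
have [u uE] := entry_min_attained z i0.
exists l, (z 0), u, w; split=> //.
- exact/eigenfun_mx.
- by move=> i; rewrite -uE entry_min_le.
- by move=> i; rewrite -wE entry_max_ge.
- by rewrite wE uE.
Qed.

(** * Eigenvectors of kites *)

(** [kite r s] with r + s - 1 replaced by the ambient number of vertices, so that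
    kites of all clique sizes are graphs on the same type. *)
Definition kite_on (n r : nat) : rel 'I_n :=
  fun i j =>
    [&& (i < r)%N, (j < r)%N & (i.+1 == j :> nat) || (j.+1 == i :> nat)]
    || [&& (r - 1 <= i)%N, (r - 1 <= j)%N & i != j].

Lemma kite_on_simple n r : simple_graph (kite_on n r).
Proof.
split=> [i j|i]; rewrite /kite_on.
  rewrite (eq_sym j i) andbCA orbC [RHS]orbC [X in _ || X]andbCA.
  by congr (_ || _); rewrite andbCA // orbC.
by rewrite eqxx !andbF orbF; apply/negP => /and3P[_ _ /orP[] /eqP]; lia.
Qed.

Lemma kite_on_connected n r : (0 < r)%N -> connected_graph (kite_on n r).
Proof.
move=> r0 i j; case: n i j => [[] //|n] i j.
suff to0 k : connect (kite_on n.+1 r) ord0 k.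
  apply: connect_trans (to0 j); rewrite sym_connect_sym //.
  by case: (kite_on_simple n.+1 r).
have path_to k' : (k' < n.+1)%N -> (k' < r)%N ->
    connect (kite_on n.+1 r) ord0 (inord k').
  elim: k' => [|k' IH] k'n k'r.
    by rewrite (_ : inord 0 = ord0) //; apply/val_inj; rewrite /= inordK.
  apply: connect_trans (IH (ltnW k'n) (ltnW k'r)) (connect1 _).
  by rewrite /kite_on !inordK ?(ltnW k'n) // (ltnW k'r) k'r eqxx.
have [kr|rk] := ltnP k r.
  by rewrite -(inord_val k); apply: path_to.
have rn : (r - 1 < n.+1)%N by have := ltn_ord k; lia.
apply: connect_trans (path_to (r - 1)%N rn _) (connect1 _); first by lia.
apply/orP; right; rewrite inordK // leqnn; apply/andP; split=> //.
by apply/andP; split; [lia | apply/eqP => /(congr1 val)/=; rewrite inordK //; lia].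
Qed.

Lemma path_nbr_sum {R : realType} (n i : nat) (Y : nat -> R) : (i < n)%N ->
  \sum_(0 <= j < n | (i.+1 == j) || (j.+1 == i)) Y j
    = (if (0 < i)%N then Y i.-1 else 0) + (if (i.+1 < n)%N then Y i.+1 else 0).
Proof.
move=> i_lt; rewrite big_mkcond /=.
rewrite (eq_bigr (fun j => (if j.+1 == i then Y j else 0)
                         + (if j == i.+1 then Y j else 0))); last first.
  move=> j _; rewrite (eq_sym i.+1).
  have [->|] := eqVneq j i.+1; last by rewrite addr0.
  by rewrite (_ : (i.+2 == i) = false) ?add0r //; apply/eqP; lia.
rewrite big_split -!big_mkcond big_nat1_eq /=; congr (_ + _).
case: i i_lt => [|i] i_lt; first by rewrite big_pred0.
rewrite (eq_bigl (fun j => j == i)) => [|j]; last by rewrite eqSS.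
by rewrite big_nat1_eq /= ltnW.
Qed.

Lemma kite_nbr_sum_path {R : realType} (n r : nat) (i : 'I_n) (Y : nat -> R) :
  (i.+1 < r)%N -> (r <= n)%N ->
  \sum_(j | kite_on n r i j) Y j = (if (0 < i)%N then Y i.-1 else 0) + Y i.+1.
Proof.
move=> ir rn.
rewrite (eq_bigl (fun j : 'I_n => (i.+1 == j) || (j.+1 == i :> nat))); last first.
  move=> j; rewrite /kite_on.
  have jn := ltn_ord j; case: (ltnP j r) => jr.
    by rewrite (_ : (r - 1 <= i)%N = false) ?orbF ?(ltnW ir) //; lia.
  rewrite (_ : (r - 1 <= i)%N = false) ?andbF /=; last by lia.
  by apply/esym/negP => /orP[] /eqP; lia.
rewrite -(big_mkord (fun j => (i.+1 == j) || (j.+1 == i :> nat)) Y).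
by rewrite path_nbr_sum // (leq_trans ir rn).
Qed.

Lemma kite_nbr_sum_neck {R : realType} (n r : nat) (i : 'I_n) (Y : nat -> R) :
  i.+1 = r -> (r <= n)%N ->
  \sum_(j | kite_on n r i j) Y j
    = (if (0 < i)%N then Y i.-1 else 0) + \sum_(r <= j < n) Y j.
Proof.
move=> ir rn; pose P j := (j < r)%N && ((i.+1 == j) || (j.+1 == i :> nat)) || (r <= j)%N.
rewrite (eq_bigl (fun j : 'I_n => P j)); last first.
  move=> j; rewrite /kite_on /P -val_eqE /=; have := ltn_ord j.
  by move: (nat_of_ord j) (nat_of_ord i) ir; lia.
rewrite -(big_mkord P Y) (big_cat_nat (n := r)) //=; congr (_ + _).
  rewrite big_nat_cond (eq_bigl (fun j => (0 <= j < r)%N && ((i.+1 == j) || (j.+1 == i :> nat)))).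
    rewrite -big_nat_cond path_nbr_sum; last by lia.
    by rewrite (_ : (i.+1 < r)%N = false) ?addr0 //; lia.
  by move=> j; rewrite /P; lia.
rewrite big_nat_cond [RHS]big_nat_cond; apply: eq_bigl => j; rewrite /P; lia.
Qed.

(** The entry at i is added on both sides because a clique vertex is adjacent to
    all the others but not to itself. *)
Lemma kite_nbr_sum_clique {R : realType} (n r : nat) (i : 'I_n) (Y : nat -> R) :
  (0 < r)%N -> (r <= i)%N ->
  Y i + \sum_(j | kite_on n r i j) Y j = Y r.-1 + \sum_(r <= j < n) Y j.
Proof.
move=> r0 ri; have i_lt := ltn_ord i.
pose P j := (j == r.-1) || ((r <= j)%N && (j != i)).
rewrite (eq_bigl (fun j : 'I_n => P j)); last first.
  move=> j; rewrite /kite_on /P -val_eqE /=.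
  by have jn := ltn_ord j; lia.
rewrite -(big_mkord P Y) (big_cat_nat (n := r)) //=; last by lia.
rewrite addrCA; congr (_ + _).
  rewrite big_nat_cond (eq_bigl (fun j => (0 <= j < r)%N && (j == r.-1))).
    by rewrite -big_nat_cond big_nat1_eq /=; case: ifP => //; lia.
  by move=> j; rewrite /P; lia.
rewrite [RHS](@bigD1_seq _ _ _ _ _ (val i)) ?iota_uniq //=; last first.
  by rewrite mem_index_iota ri.
congr (_ + _).
rewrite big_nat_cond [RHS]big_nat_cond; apply: eq_bigl => j; rewrite /P; lia.
Qed.

(** The equation says that path entries U_1(k), ..., U_r(k) extend by a constant
    w on the M remaining clique vertices, with w (k - M + 1) = U_r(k) from such a
    vertex and M w = U_(r+1)(k) from the neck.  At k = M the difference of its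
    two sides is - U_(r-1)(M) < 0, and it is positive at k = M + 1. *)
Lemma kite_eigenvalue_exists {R : realType} (r M : nat) :
  (2 <= r)%N -> (2 <= M)%N ->
  exists2 k : R, M%:R < k
    & (k - M%:R + 1) * cheb k r.+1 = M%:R * cheb k r.
Proof.
case: r => [|[|r]] // _ M2.
have M2R : 2 <= M%:R :> R by rewrite (ler_nat _ 2).
set m : R := M%:R in M2R *.
pose f := ('X - m%:P + 1) * cheb 'X r.+3 - m%:P * cheb 'X r.+2.
have fE k : f.[k] = (k - m + 1) * cheb k r.+3 - m * cheb k r.+2.
  by rewrite /f hornerD hornerN !hornerM !horner_cheb hornerD hornerXsubC !hornerC.
have lo : f.[m] < 0.
  rewrite fE subrr add0r mul1r chebSS.
  by have := cheb_gt0 m r M2R; lra.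
have hi : 0 < f.[m + 1].
  rewrite fE (_ : m + 1 - m + 1 = 2); last by ring.
  have := cheb_ratio_ge (m + 1) r.+2 ltac:(lra).
  have := cheb_gt0 (m + 1) r.+1 ltac:(lra).
  by rewrite addrK; nra.
have [||k /andP[k1 _] /rootP] := @poly_ivt R f m (m + 1); first by lra.
  by rewrite ltW ?ltW.
move=> fk; exists k.
  by rewrite lt_neqAle k1 andbT; apply: contraTneq lo => ->; rewrite fk ltxx.
by apply/eqP; rewrite -subr_eq0 -fE fk.
Qed.

Lemma kite_path_entries {R : realType} (n r : nat) (k : R) (Y : nat -> R) :
  (r <= n)%N -> eigenfun (kite_on n r) k (fun i => Y i) ->
  forall i, (i < r)%N -> Y i = cheb k i.+1 * Y 0%N.
Proof.
move=> rn YE.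
have step i : (i.+1 < r)%N -> Y i.+1 = k * Y i - (if (0 < i)%N then Y i.-1 else 0).
  move=> ir; have i_n : (i < n)%N by lia.
  have := YE (Ordinal i_n); rewrite kite_nbr_sum_path //= => <-.
  by rewrite addrC addKr.
suff H i : ((i < r)%N -> Y i = cheb k i.+1 * Y 0%N) /\
           ((i.+1 < r)%N -> Y i.+1 = cheb k i.+2 * Y 0%N).
  by move=> i; case: (H i).
elim: i => [|i [IH0 IH1]].
  split=> [_|/step ->]; first by rewrite cheb1 mul1r.
  by rewrite chebSS cheb1 cheb0 mulr1 !subr0.
split=> // ir; rewrite step //= IH1 ?IH0; try lia.
by rewrite (chebSS k i.+1); ring.
Qed.

Lemma kite_eigenfun_exists {R : realType} (n r M : nat) :
  (r + M = n)%N -> (2 <= r)%N -> (2 <= M)%N ->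
  exists (k : R) (y : 'I_n -> R), [/\ M%:R < k,
    forall i, 0 < y i & eigenfun (kite_on n r) k y].
Proof.
move=> rMn r2 M2.
have [k k1 kE] := @kite_eigenvalue_exists R r M r2 M2.
have M2R : 2 <= M%:R :> R by rewrite (ler_nat _ 2).
have k_ge2 : 2 <= k by lra.
have q0 : 0 < k - M%:R + 1 by lra.
pose w := cheb k r / (k - M%:R + 1).
have wE : w * (k - M%:R + 1) = cheb k r by rewrite mulfVK ?gt_eqF.
have MwE : w * M%:R = cheb k r.+1.
  by apply: (mulIf (lt0r_neq0 q0)); rewrite mulrAC wE mulrC -kE mulrC.
pose Y j := if (j < r)%N then cheb k j.+1 else w.
have r_gt0 : 0 < cheb k r by case: (r) r2 => // r' _; exact: cheb_gt0.
exists k, (fun i => Y i); split=> // [i|].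
  rewrite /Y; case: ifP => _; first exact: cheb_gt0.
  by rewrite divr_gt0.
have YC : \sum_(r <= j < n) Y j = M%:R * w.
  rewrite (eq_big_nat _ _ (F2 := fun=> w)) => [|j /andP[rj _]].
    by rewrite big_const_nat iter_addr_0 mulr_natl (_ : n - r = M)%N //; lia.
  by rewrite /Y ltnNge rj.
move=> i; have i_n := ltn_ord i.
have pathY : (i < r)%N -> (if (0 < i)%N then Y i.-1 else 0) = cheb k i.
  rewrite /Y; case: (nat_of_ord i) => [//|i'] /= ir.
  by rewrite ltnW.
have [ir|ri|ir] := ltngtP i.+1 r.
- rewrite kite_nbr_sum_path //; last by lia.
  rewrite pathY; last exact: ltnW.
  by rewrite /Y ir (ltnW ir) chebSS addrC subrK.
- have {}ri : (r <= i)%N by [].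
  have := @kite_nbr_sum_clique R n r i Y ltac:(lia) ri.
  have -> : Y i = w by rewrite /Y ltnNge ri.
  have -> : Y r.-1 = cheb k r by rewrite /Y prednK ?leqnn //; lia.
  rewrite YC -wE => h; apply: (addrI w); rewrite h; ring.
- rewrite kite_nbr_sum_neck //; last by lia.
  rewrite pathY ?ir // YC mulrC MwE /Y -ir ltnSn.
  by rewrite chebSS addrC subrK.
Qed.

(** The ratio is read off between the end of the path and its neck, where the
    entries of every eigenvector for k are those of [kite_path_entries]. *)
Lemma kite_principal_ratio {R : realType} (n r M : nat) :
  (r + M = n)%N -> (2 <= r)%N -> (2 <= M)%N ->
  exists (k : R) (y : 'I_n -> R), [/\ M%:R < k, forall i, 0 < y i,
    eigenfun (kite_on n r) k y & cheb k r <= principal_ratio R (kite_on n r)].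
Proof.
move=> rMn r2 M2.
have [k [y [k1 y0 yE]]] := @kite_eigenfun_exists R n r M rMn r2 M2.
exists k, y; split=> //.
case: n rMn y y0 yE => [|n] rMn y y0 yE; first by lia.
have [z0 zE] := principal_eigenvector_spec _ k y ord0 (kite_on_simple n.+1 r).1 y0 yE.
set z := principal_eigenvector R _ in z0 zE.
pose Y j := z 0 (inord j).
have YE : eigenfun (kite_on n.+1 r) k (fun i => Y i).
  move=> i; rewrite /Y inord_val -zE; apply: eq_bigr => j _.
  by rewrite inord_val.
have rE : (r.-1 < r)%N by lia.
have := @kite_path_entries R n.+1 r k Y ltac:(lia) YE r.-1 rE.
rewrite prednK; last by lia.
move=> Yr.
have Y0 : 0 < Y 0%N by exact: z0.
have -> : cheb k r = Y r.-1 / Y 0%N by rewrite Yr mulfK ?gt_eqF.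
exact: ratio_le_principal_ratio.
Qed.

(** * Shortest paths *)

(** The function d is the distance from u.  That it changes by at most one along
    an edge is what makes the path chordless. *)
Lemma geodesic {T : finType} (e : rel T) (u w : T) :
  symmetric e -> connected_graph e ->
  exists (d : T -> nat) (v : nat -> T),
    [/\ forall a b, e a b -> (d b <= (d a).+1)%N,
        v 0%N = u /\ v (d w) = w,
        forall i, (i <= d w)%N -> d (v i) = i
      & forall i, (i < d w)%N -> e (v i) (v i.+1)].
Proof.
move=> e_sym e_conn.
have walk a : exists k, [exists p : k.-tuple T, path e u p && (last u p == a)].
  have /connectP[p pP ->] := e_conn u a.
  by exists (size p); apply/existsP; exists (in_tuple p); rewrite pP eqxx.
pose d a := ex_minn (walk a).
have dP a : exists p, [/\ path e u p, last u p = a & size p = d a].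
  rewrite /d; case: ex_minnP => k /existsP[p /andP[pP /eqP lp]] _.
  by exists p; rewrite size_tuple.
have d_min p : path e u p -> (d (last u p) <= size p)%N.
  move=> pP; rewrite /d; case: ex_minnP => k _; apply.
  by apply/existsP; exists (in_tuple p); rewrite pP eqxx.
have d_step a b : e a b -> (d b <= (d a).+1)%N.
  move=> eab; have [p [pP lp <-]] := dP a.
  have := d_min (rcons p b); rewrite last_rcons size_rcons; apply.
  by rewrite rcons_path pP lp.
have d0 a : d a = 0%N -> a = u.
  move=> da; have [p [_ lp sp]] := dP a.
  by rewrite -lp (size0nil (etrans sp da)).
have d_pred b k : d b = k.+1 -> exists2 a, e a b & d a = k.
  move=> db; have [p [pP lp sp]] := dP b.
  case/lastP: p pP lp sp => [|p b']; first by rewrite db.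
  rewrite last_rcons size_rcons rcons_path => /andP[pP eb] b'E.
  rewrite db => -[sp]; exists (last u p); first by rewrite -b'E.
  apply/eqP; rewrite eqn_leq -{1}sp d_min //=.
  by rewrite -ltnS -db -b'E d_step.
(* The path is built backwards from w along vertices of decreasing distance. *)
suff [v [vw vd ve]] : exists v : nat -> T, [/\ v (d w) = w,
    forall i, (i <= d w)%N -> d (v i) = i
  & forall i, (i < d w)%N -> e (v i) (v i.+1)].
  by exists d, v; split=> //; split=> //; apply/d0/vd.
have [k dw] : exists k, d w = k by exists (d w).
rewrite dw; elim: k w dw => [|k IH] w dw.
  by exists (fun=> w); split=> // i; rewrite leqn0 => /eqP->.
have [a eaw da] := d_pred w k dw.
have [v [va vd ve]] := IH a da.
exists (fun i => if i == k.+1 then w else v i); split=> [|i|i].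
- by rewrite eqxx.
- by case: eqVneq => [->//|ne] ik; apply: vd; lia.
rewrite ltnS leq_eqVlt => /orP[/eqP->|ik].
  by rewrite eqxx va (_ : (k == k.+1) = false) //; lia.
by rewrite !ifN ?ve //; lia.
Qed.

(** The ratios y_(i+1) / y_i satisfy the recursion of the ratios
    U_(i+2) / U_(i+1), with an inequality in place of the equality. *)
Lemma path_growth {R : realType} (D : nat) (l : R) (y : nat -> R) :
  2 <= l -> (forall i, (i <= D)%N -> 0 < y i) ->
  (forall i, (i < D)%N -> (if (0 < i)%N then y i.-1 else 0) + y i.+1 <= l * y i) ->
  forall i j, (i <= j <= D)%N -> y j * cheb l i.+1 <= y i * cheb l j.+1.
Proof.
move=> l2 y0 yl.
have step i : (i < D)%N -> y i.+1 * cheb l i.+1 <= y i * cheb l i.+2.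
  elim: i => [|i IH] iD.
    by have := yl 0%N iD; rewrite /= add0r chebSS !cheb1 cheb0; lra.
  have := yl i.+1 iD => /=; have := IH (ltnW iD).
  have := cheb_gt0 l i.+1 l2; rewrite (chebSS l i.+1).
  move: (cheb l i.+2) (cheb l i.+1) => b a b0 h1 h2.
  have : (y i + y i.+2) * b <= l * y i.+1 * b by rewrite ler_pM2r.
  lra.
move=> i j; elim: j => [|j IH] /andP[ij jD].
  by move: ij; rewrite leqn0 => /eqP->.
move: ij; rewrite leq_eqVlt => /orP[/eqP->//|ij].
have := IH ltac:(lia); have := step j jD.
have c0 := cheb_gt0 l j l2; have c1 := cheb_gt0 l i l2; have c2 := cheb_gt0 l j.+1 l2.
move=> h1 h2; rewrite -(ler_pM2r c0).
apply: (@le_trans _ _ (y j * cheb l i.+1 * cheb l j.+2)).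
  by rewrite mulrAC [leRHS]mulrAC ler_pM2r.
by rewrite [leRHS]mulrAC ler_pM2r.
Qed.

Lemma nbr_sum_le {R : realType} {T : finType} (e : rel T) (l : R) (x : T -> R)
    (a : T) (s : seq T) :
  (forall b, 0 < x b) -> eigenfun e l x -> uniq s -> all (e a) s ->
  \sum_(b <- s) x b <= l * x a.
Proof.
move=> x0 xE s_uniq /allP s_nbr; rewrite -xE big_uniq //=.
rewrite big_mkcond [leRHS]big_mkcond; apply: ler_sum => b _.
by case: ifP => [/s_nbr->//|_]; case: ifP => // _; apply: ltW.
Qed.

(** List the path first and all other vertices after it: the only edges that can
    occur are those of the path and those among the last path vertex and the
    vertices off the path. *)
Lemma kite_relabel {T : finType} (e : rel T) (n D : nat) (v : nat -> T) :
  #|T| = n ->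
  {in [pred i | (i <= D)%N] &, injective v} ->
  (forall i j, (i <= D)%N -> (j <= D)%N -> e (v i) (v j) -> (i.+1 == j) || (j.+1 == i)) ->
  (forall i c, (i < D)%N -> (forall j, (j <= D)%N -> c != v j) -> ~~ e (v i) c) ->
  symmetric e -> irreflexive e ->
  exists2 h : T -> 'I_n, bijective h &
    forall a b, e a b -> kite_on n D.+1 (h a) (h b).
Proof.
move=> cardT v_inj v_path v_C e_sym e_irr.
pose s := [seq v i | i <- iota 0 D.+1].
pose C := [seq c <- enum T | c \notin s].
have s_uniq : uniq s.
  rewrite map_inj_in_uniq ?iota_uniq // => i j.
  by rewrite !mem_iota !ltnS; apply: v_inj.
have ss : size s = D.+1 by rewrite size_map size_iota.
have sC_uniq : uniq (s ++ C).
  rewrite cat_uniq s_uniq filter_uniq ?enum_uniq // andbT.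
  by apply/hasPn => c; rewrite mem_filter => /andP[].
have sC_all a : a \in s ++ C.
  by rewrite mem_cat mem_filter mem_enum andbT orbN.
have sC_size : size (s ++ C) = n.
  by rewrite -cardT -(card_uniqP sC_uniq); apply: eq_card => a; rewrite sC_all.
have h_lt a : (index a (s ++ C) < n)%N by rewrite -sC_size index_mem.
pose h a := Ordinal (h_lt a); have hE a : h a = index a (s ++ C) :> nat by [].
have h_inj : injective h.
  move=> a b [] /(congr1 (nth a (s ++ C))); rewrite !nth_index //.
exists h; first by apply: inj_card_bij => //; rewrite card_ord cardT.
have h_path a : a \in s -> exists2 i, (i <= D)%N & a = v i /\ h a = i :> nat.
  move=> as_; have ia : (index a s < D.+1)%N by rewrite -ss index_mem.
  exists (index a s) => //; split; last by rewrite hE index_cat as_.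
  by rewrite -[LHS](nth_index a as_) (nth_map 0%N) ?size_iota // nth_iota.
have h_C a : a \notin s -> (D < h a)%N /\ forall j, (j <= D)%N -> a != v j.
  move=> as_; split; first by rewrite hE index_cat (negbTE as_) ss; lia.
  move=> j jD; apply: contraNneq as_ => ->; apply/mapP; exists j => //.
  by rewrite mem_iota.
have half a b : e a b -> b \notin s -> kite_on n D.+1 (h a) (h b).
  move=> eab bs; have [hb bv] := h_C b bs.
  apply/orP; right; apply/and3P; rewrite subn1; split; last first.
  - by rewrite (inj_eq h_inj); apply: contraTneq eab => ->; rewrite e_irr.
  - exact: ltnW.
  have [/h_path[i iD [aE ->]]|/h_C[ha _]] := boolP (a \in s); last exact: ltnW.
  rewrite leqNgt; apply/negP => iD'; move: eab.
  by rewrite aE (negbTE (v_C i b iD' bv)).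
move=> a b eab.
have [bs|bs] := boolP (b \in s); last exact: half.
have [as_|as_] := boolP (a \in s); last first.
  by rewrite (kite_on_simple _ _).1; apply: half => //; rewrite e_sym.
have [i iD [aE hi]] := h_path a as_; have [j jD [bE hj]] := h_path b bs.
apply/orP; left; rewrite hi hj !ltnS iD jD /=.
by apply: v_path => //; rewrite -aE -bE.
Qed.

(** * Eigenvectors along a shortest path *)

Definition off_path {T : finType} (v : nat -> T) (D : nat) : pred T :=
  fun b => [forall i : 'I_D.+1, b != v i].

Section GeodesicEigenfun.

Context {R : realType} {T : finType} {e : rel T} {l : R} {x : T -> R}.
Context {D : nat} {v : nat -> T}.
Context (x_gt0 : forall a, 0 < x a) (x_eigen : eigenfun e l x).
Context (e_sym : symmetric e).
Context (v_inj : {in [pred i | (i <= D)%N] &, injective v}).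
Context (v_edge : forall i, (i < D)%N -> e (v i) (v i.+1)).
Context (v_chordless : forall i j, (i <= D)%N -> (j <= D)%N ->
  e (v i) (v j) -> (i.+1 == j) || (j.+1 == i)).

Lemma off_pathP b : reflect (forall i, (i <= D)%N -> b != v i) (off_path v D b).
Proof.
apply: (iffP forallP) => [bv i iD|bv i]; first exact: (bv (Ordinal (iD : (i < D.+1)%N))).
by apply: bv; rewrite -ltnS.
Qed.

Lemma card_off_path : (#|off_path v D| + D.+1 = #|T|)%N.
Proof.
pose s := [seq v i | i <- iota 0 D.+1].
have s_uniq : uniq s.
  rewrite map_inj_in_uniq ?iota_uniq // => i j.
  by rewrite !mem_iota !ltnS; apply: v_inj.
rewrite -(cardC (off_path v D)); congr (_ + _)%N.
rewrite -[LHS](size_iota 0) -(size_map v) -(card_uniqP s_uniq).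
apply: eq_card => b; rewrite [RHS]inE; apply/mapP/idP => [[i + ->]|].
  rewrite mem_iota ltnS => iD; apply/negP => /off_pathP/(_ i iD).
  by rewrite eqxx.
rewrite negb_forall => /existsP[i]; rewrite negbK => /eqP->.
by exists (val i) => //; rewrite mem_iota /= ltn_ord.
Qed.

Lemma path_deficit i s : (i < D)%N -> uniq s -> all (off_path v D) s ->
  all (e (v i)) s ->
  (if (0 < i)%N then x (v i.-1) else 0) + (x (v i.+1) + \sum_(c <- s) x c)
    <= l * x (v i).
Proof.
move=> iD s_uniq s_off s_nbr.
have iD' := ltnW iD.
have v_notin j : (j <= D)%N -> v j \notin s.
  by move=> jD; apply/negP => /(allP s_off)/off_pathP/(_ j jD); rewrite eqxx.
have nextE : x (v i.+1) + \sum_(c <- s) x c = \sum_(c <- v i.+1 :: s) x c.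
  by rewrite big_cons.
rewrite nextE; case: i iD iD' s_nbr {nextE} => [|i] iD iD' s_nbr.
  rewrite add0r; apply: (nbr_sum_le e) => //=; first by rewrite v_notin.
  by rewrite v_edge.
rewrite [_ + _](_ : _ = \sum_(c <- [:: v i, v i.+2 & s]) x c); last first.
  by rewrite [RHS]big_cons.
apply: (nbr_sum_le e) => //=; last first.
  by rewrite v_edge // e_sym v_edge // ltnW.
rewrite inE negb_or !v_notin ?s_uniq ?andbT ?(ltnW iD') //.
by apply/eqP => /v_inj; rewrite !inE => /(_ (ltnW iD') iD); lia.
Qed.

Lemma path_inequality i : (i < D)%N ->
  (if (0 < i)%N then x (v i.-1) else 0) + x (v i.+1) <= l * x (v i).
Proof. by move=> iD; have := path_deficit i [::] iD isT isT isT; rewrite big_nil addr0. Qed.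

Lemma eigenvalue_gt0 : (0 < D)%N -> 0 < l.
Proof.
move=> D0; have := path_inequality 0 D0; rewrite add0r => h.
by rewrite -(pmulr_lgt0 _ (x_gt0 (v 0%N))); apply: lt_le_trans h.
Qed.

Lemma path_power_bound i : (i <= D)%N -> x (v i) <= l ^+ i * x (v 0%N).
Proof.
elim: i => [|i IH] iD; first by rewrite mul1r.
have l0 : 0 < l by apply: eigenvalue_gt0; lia.
rewrite exprS -mulrA; apply: le_trans (ler_wpM2l (ltW l0) (IH (ltnW iD))).
apply: le_trans (path_inequality i iD); rewrite lerDr.
by case: ifP => // _; apply: ltW.
Qed.

Lemma path_cheb_bound i : 2 <= l -> (i <= D)%N ->
  x (v i) <= cheb l i.+1 * x (v 0%N).
Proof.
move=> l2 iD.
have := @path_growth R D l (x \o v) l2 (fun i _ => x_gt0 (v i)) path_inequality 0 i iD.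
by rewrite cheb1 mulr1 mulrC.
Qed.

(** Compared with [path_cheb_bound], the neighbour c off the path takes its share
    x(c) out of the growth from v_i to v_(i+1). *)
Lemma path_cheb_deficit i c : 2 <= l -> (i < D)%N -> off_path v D c ->
  e (v i) c -> x (v i.+1) + x c <= cheb l i.+2 * x (v 0%N).
Proof.
move=> l2 iD c_off c_nbr.
have := path_deficit i [:: c] iD isT; rewrite /= c_off c_nbr big_seq1 => /(_ isT isT).
move=> h; have yi := path_cheb_bound i l2 (ltnW iD).
have c0 := cheb_gt0 l i l2.
suff h2 : (x (v i.+1) + x c) * cheb l i.+1 <= x (v i) * cheb l i.+2.
  rewrite -(ler_pM2r c0); apply: le_trans h2 _.
  rewrite [leRHS](_ : _ = cheb l i.+1 * x (v 0%N) * cheb l i.+2); last by ring.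
  by rewrite ler_pM2r ?cheb_gt0.
have := @path_growth R D l (x \o v) l2 (fun i _ => x_gt0 (v i)) path_inequality i.-1 i.
rewrite /= => /(_ ltac:(lia)).
case: i iD c_nbr h yi c0 => [|i] iD c_nbr /= h yi c0 g.
  by move: h; rewrite chebSS cheb1 cheb0 add0r; lra.
rewrite (chebSS l i.+1) [leRHS]mulrBr.
have := ler_wpM2r (ltW c0) h; rewrite mulrDl.
lra.
Qed.

Context (x_max : forall a, x a <= x (v D)).

Lemma end_vertex_sum :
  l * x (v D) = (if (0 < D)%N then x (v D.-1) else 0)
                + \sum_(b | off_path v D b) (e (v D) b)%:R * x b.
Proof.
rewrite -x_eigen (bigID (off_path v D)) /= addrC; congr (_ + _); last first.
  rewrite big_mkcondl; apply: eq_bigr => b _.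
  by case: (e _ b); rewrite ?mul1r ?mul0r.
have on b : e (v D) b && ~~ off_path v D b = (0 < D)%N && (b == v D.-1).
  apply/andP/andP => [[eb]|[D0 /eqP->]]; last first.
    split; first by have := v_edge D.-1; rewrite prednK // e_sym; apply.
    by apply/negP => /off_pathP/(_ D.-1 (leq_pred D)); rewrite eqxx.
  rewrite negb_forall => /existsP[i]; rewrite negbK => /eqP bE.
  have iD : (i <= D)%N by rewrite -ltnS ltn_ord.
  have := v_chordless D i (leqnn D) iD; rewrite -bE => /(_ eb) /orP[] /eqP iE; first lia.
  by split; [lia | rewrite bE; apply/eqP; congr (v _); lia].
rewrite (eq_bigl _ _ on); case: (0 < D)%N; last by rewrite big_pred0.
by rewrite big_pred1_eq.
Qed.

Lemma end_vertex_bound m : (m + D.+1 = #|T|)%N ->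
  l * x (v D) <= (if (0 < D)%N then x (v D.-1) else 0) + m%:R * x (v D).
Proof.
rewrite -card_off_path => /addIn mE; rewrite end_vertex_sum lerD2l mE.
rewrite mulr_natl -sumr_const; apply: ler_sum => b _.
by case: (e _ b); rewrite ?mul1r ?mul0r // ltW.
Qed.

(** The equation at v_D with every entry off the path except that of c bounded by
    the maximum.  When l > m it forces c to be adjacent to v_D and x(c) to be
    at least x(v_D) - x(v_(D-1)). *)
Lemma end_vertex_bound_off m c : (m + D.+1 = #|T|)%N -> off_path v D c ->
  (l - m%:R + 1) * x (v D)
    <= (if (0 < D)%N then x (v D.-1) else 0) + (e (v D) c)%:R * x c.
Proof.
rewrite -card_off_path => /addIn mE c_off.
have := end_vertex_sum; rewrite (bigD1 c) //= addrA => lE.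
have : \sum_(b | off_path v D b && (b != c)) (e (v D) b)%:R * x b
    <= (m%:R - 1) * x (v D).
  apply: (@le_trans _ _ (\sum_(b | off_path v D b && (b != c)) x (v D))).
    by apply: ler_sum => b _; case: (e _ b); rewrite ?mul1r ?mul0r // ltW.
  have : \sum_(b | off_path v D b) x (v D) = m%:R * x (v D).
    by rewrite sumr_const mE mulr_natl.
  rewrite (bigD1 c) //=; lra.
lra.
Qed.

(** The hypothesis on [cheb l D.+1] says that less than a factor 3/2 is lost along
    the path.  As U_(D+1)(l) >= (l - 1) U_D(l), the entry at v_(D-1) is then
    below half of the maximum, so x(c) exceeds half of the maximum.  A
    neighbour c of v_(D-1) would cost the factor 3/2; a neighbour of an
    earlier v_i would have an entry of size at most U_D(l) x(v_0), which is too
    small. *)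
Lemma off_path_at_end m : (m + D.+1 = #|T|)%N -> (2 <= D)%N -> 4 <= m%:R :> R ->
  m%:R < l -> 2 * (cheb l D.+1 * x (v 0%N)) < 3 * x (v D) ->
  forall i c, (i < D)%N -> off_path v D c -> ~~ e (v i) c.
Proof.
move=> mE D2 m4 ml loss i c iD c_off; apply/negP => eic.
have l2 : 2 <= l by lra.
have y0 := x_gt0 (v 0%N); have yD := x_gt0 (v D).
have ratioD : (l - 1) * (cheb l D * x (v 0%N)) <= cheb l D.+1 * x (v 0%N).
  by rewrite mulrA ler_pM2r // cheb_ratio_ge.
have small : cheb l D * x (v 0%N) < x (v D) / 2.
  by have := mulr_ge0 (cheb_ge0 l D l2) (ltW y0); nra.
have pen : x (v D.-1) <= cheb l D * x (v 0%N).
  by have := path_cheb_bound D.-1 l2 (leq_pred D); rewrite prednK //; lia.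
have xc : x (v D) / 2 < x c.
  have := end_vertex_bound_off m c mE c_off; rewrite (ltnW D2).
  by have := x_gt0 c; case: (e _ c); rewrite ?mul1r ?mul0r; nra.
have := path_cheb_deficit i c l2 iD c_off eic.
have [iE|iD1] := eqVneq i.+1 D; first by rewrite iE; lra.
have mono : cheb l i.+2 <= cheb l D.
  have : (i.+2 <= D)%N by rewrite ltn_neqAle iD1 iD.
  elim: (D) => [//|k IH]; rewrite leq_eqVlt => /orP[/eqP->//|/IH h].
  exact: le_trans h (cheb_nondec l k l2).
have := x_gt0 (v i.+1); have := ler_wpM2r (ltW y0) mono; lra.
Qed.

End GeodesicEigenfun.

(** * Extremal graphs *)

Lemma iso_kite_on {T : finType} (G : rel T) (n r s : nat) :
  (r + s - 1)%N = n -> graph_isomorphic G (kite_on n r) ->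
  graph_isomorphic G (kite r s).
Proof. by move=> <-. Qed.

Lemma eigenfun_relabel {R : realType} {T U : finType} (f : rel U) (k : R)
    (y : U -> R) (h : T -> U) :
  bijective h -> eigenfun f k y ->
  eigenfun (fun a b => f (h a) (h b)) k (y \o h).
Proof.
move=> h_bij yE a /=; rewrite -yE [RHS](reindex h) //=.
exact: onW_bij.
Qed.

Theorem theorem1 (R : realType) :
  exists n0 : nat, forall n : nat, (n0 <= n)%N ->
  forall G : rel 'I_n, simple_graph G -> connected_graph G ->
  (forall H : rel 'I_n, simple_graph H -> connected_graph H ->
     principal_ratio R H <= principal_ratio R G) ->
  exists r s : nat,
    [/\ (0 < r)%N, (0 < s)%N, (r + s - 1 = n)%N
      & graph_isomorphic G (kite r s)].
Proof.
have [n0 race] := long_path_large_rest 257.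
exists (n0 + 5)%N => n n_ge G [G_sym G_irr] G_conn G_max.
(* Extremality is used only against kites. *)
have kite_le r M : (r + M = n)%N -> (2 <= r)%N -> (2 <= M)%N ->
    exists (k : R) (y : 'I_n -> R), [/\ M%:R < k, forall i, 0 < y i,
      eigenfun (kite_on n r) k y & cheb k r <= principal_ratio R G].
  move=> rMn r2 M2; have [k [y [k1 y0 yE yr]]] := @kite_principal_ratio R n r M rMn r2 M2.
  exists k, y; split=> //; apply: le_trans yr _; apply: G_max.
    exact: kite_on_simple.
  by apply: kite_on_connected; apply: ltnW.
have i0 : 'I_n by apply: (@Ordinal n 0); lia.
(* Any kite shows that the ratio of G is positive, hence not the junk value. *)
have ratio0 : 0 < principal_ratio R G.
  have [k [_ [k1 _ _ kr]]] := kite_le 2 (n - 2)%N ltac:(lia) isT ltac:(lia).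
  have M2 : 2 <= (n - 2)%:R :> R by rewrite (ler_nat _ 2); lia.
  by apply: lt_le_trans kr; apply: cheb_gt0; lra.
have [l [x [u [w [x0 xE xu xw ratioE]]]]] := positive_principal_ratio G i0 G_sym ratio0.
have [d [v [d_step [v0 vw] vd v_edge]]] := geodesic G u w G_sym G_conn.
set D := d w in vw vd v_edge.
have v_inj : {in [pred i | (i <= D)%N] &, injective v}.
  by move=> i j iD jD vij; rewrite -(vd i iD) -(vd j jD) vij.
have v_chordless i j : (i <= D)%N -> (j <= D)%N -> G (v i) (v j) ->
    (i.+1 == j) || (j.+1 == i).
  move=> iD jD vij; have ij : i != j.
    by apply: contraTneq vij => ->; rewrite G_irr.
  have := d_step _ _ vij; rewrite G_sym in vij; have := d_step _ _ vij.
  by rewrite !vd //; lia.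
rewrite -v0 -vw in ratioE.
have x_max a : x a <= x (v D) by rewrite vw.
have y0 := x0 (v 0%N); have yD := x0 (v D).
have kite_entry r M : (r + M = n)%N -> (2 <= r)%N -> (2 <= M)%N ->
    exists (k : R) (y : 'I_n -> R), [/\ M%:R < k, forall i, 0 < y i,
      eigenfun (kite_on n r) k y & cheb k r * x (v 0%N) <= x (v D)].
  move=> rMn r2 M2; have [k [y [k1 yp yE kr]]] := kite_le r M rMn r2 M2.
  by exists k, y; split=> //; rewrite -ler_pdivlMr // -ratioE.
have power := path_power_bound x0 xE G_sym v_inj v_edge D (leqnn D).
have := card_off_path v_inj; rewrite card_ord.
set m := #|_| => mn.
have mT : (m + D.+1 = #|'I_n|)%N by rewrite card_ord.
have end_le := end_vertex_bound x0 xE G_sym v_inj v_edge v_chordless x_max m mT.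
have l_le : l <= m%:R + 1.
  rewrite -(ler_pM2r yD); apply: le_trans end_le _; rewrite addrC mulrDl mul1r lerD2l.
  by case: ifP => _; [apply: x_max | apply: ltW].
have l0 : 0 <= l.
  rewrite leNgt; apply/negP => l_lt0; have := xE (v 0%N).
  have : 0 <= \sum_(b | G (v 0%N) b) x b by apply: sumr_ge0 => b _; apply: ltW.
  by move=> h hE; move: h; rewrite hE; nra.
(* The bounds U_(r+1)(k) >= (k - 1)^r for kites and l^D <= (m + 1)^D for G are
   what the comparison of exponentials needs.  257 leaves room for the
   passage from D to N = D - 1 in the constant 256 used below. *)
have [m_ge D_ge] : (257 <= m)%N /\ (257 * m.+1 <= D)%N.
  apply: race => [|a r ar a0 r0]; first by lia.
  have [k [y [k1 _ _ kr]]] := kite_entry r.+1 a.+1 ltac:(lia) r0 a0.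
  have a1 : 1 <= a%:R :> R by rewrite (ler_nat _ 1).
  rewrite -natr1 in k1.
  have ar_le : a%:R ^+ r * x (v 0%N) <= (m%:R + 1) ^+ D * x (v 0%N).
    apply: (@le_trans _ _ (cheb k r.+1 * x (v 0%N))).
      rewrite ler_pM2r //; apply: le_trans (cheb_geX k r _); last by lra.
      by rewrite lerXn2r ?nnegrE //; lra.
    apply: le_trans kr _; apply: le_trans power _.
    by rewrite ler_pM2r // lerXn2r ?nnegrE //; lra.
  by move: ar_le; rewrite ler_pM2r // natr1 -!natrX ler_nat.
have m8 : (8 <= m)%N by apply: leq_trans m_ge.
have mD : (m.+1 <= D)%N by apply: leq_trans D_ge; rewrite leq_pmull.
have [N DE] : exists N, D = N.+1 by exists D.-1; lia.
have [D1 D2 N_gt0 nE nE'] : [/\ (0 < D)%N, (2 <= D)%N, (0 < N)%N,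
  (D.+1 + m)%N = n & (D + m.+1)%N = n] by split; lia.
have ND : (N <= D)%N by rewrite DE.
have m2 : (2 <= m)%N by apply: leq_trans m8.
have D_geR : 257 * (m%:R + 1) <= D%:R :> R.
  by rewrite natr1 -(natrM _ 257) ler_nat.
clear m_ge D_ge.
have m8R : 8 <= m%:R :> R by rewrite (ler_nat _ 8).
have [k [y [k1 yp yE kr]]] := kite_entry D.+1 m nE (ltnW D2) m2.
(* Needed before the Chebyshev bound applies to l; the power bound gives it. *)
have l2 : 2 <= l.
  rewrite leNgt; apply/negP => l_lt2.
  have : (k - 1) ^+ D * x (v 0%N) <= l ^+ D * x (v 0%N).
    apply: le_trans power; apply: le_trans kr.
    by rewrite ler_pM2r // cheb_geX //; lra.
  rewrite ler_pM2r // => pow_le.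
  have k1_ge0 : 0 <= k - 1 by lra.
  suff : k - 1 <= l by lra.
  by rewrite -(ler_pXn2r D1).
have growth := path_cheb_bound x0 xE G_sym v_inj v_edge.
(* U_(D+1)(k) x(v_0) <= x(v_D) <= U_(D+1)(l) x(v_0). *)
have kl : k <= l.
  rewrite leNgt; apply/negP => lk.
  have := le_trans kr (growth D l2 (leqnn D)); rewrite ler_pM2r //.
  have : cheb l D.+1 < cheb k D.+1.
    by rewrite DE; apply: cheb_lt.
  lra.
have ml : m%:R < l by lra.
have pen : (l - m%:R) * x (v D) <= x (v N).
  by move: end_le; rewrite DE /= mulrBl; lra.
pose t := l - m%:R.
have lE : l = m%:R + t by rewrite /t; ring.
(* Otherwise the kite with one path vertex fewer has a larger ratio. *)
have t_small : 16 * N%:R * t < m%:R + 1.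
  rewrite ltNge; apply/negP => t_large.
  have [k' [_ [k'1 _ _ k'r]]] := kite_entry D m.+1 nE' D2 (leqW m2).
  rewrite -natr1 in k'1.
  have := cheb_large_shift m N t m2 ltac:(rewrite DE -natr1 in D_geR; lra) ltac:(rewrite /t; lra) ltac:(rewrite /t; lra) t_large.
  rewrite -lE => shift.
  have := growth N l2 ND => yN.
  have : cheb (m%:R + 1) N.+1 < cheb k' N.+1.
    by case: (N) N_gt0 => [//|N'] _; apply: cheb_lt => //; lra.
  rewrite -DE in shift yN *; move=> lt.
  have t0 : 0 < t by rewrite /t; lra.
  have : t * (cheb (m%:R + 1) D * x (v 0%N)) < t * (cheb k' D * x (v 0%N)).
    by rewrite ltr_pM2l // ltr_pM2r.
  have : t * (cheb k' D * x (v 0%N)) <= t * x (v D) by rewrite ler_pM2l.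
  have : cheb l D * x (v 0%N) <= t * cheb (m%:R + 1) D * x (v 0%N) by rewrite ler_pM2r.
  rewrite -/t in pen; lra.
have loss : 2 * (cheb l D.+1 * x (v 0%N)) < 3 * x (v D).
  have := cheb_small_shift m N t m8 N_gt0 ltac:(rewrite /t; lra) t_small.
  rewrite -lE -DE => shift.
  have : cheb m%:R D.+1 <= cheb k D.+1 by apply: cheb_le; lra.
  move=> /(ler_wpM2r (ltW y0)).
  have : 2 * cheb l D.+1 * x (v 0%N) < 3 * cheb m%:R D.+1 * x (v 0%N) by rewrite ltr_pM2r.
  lra.
have off := off_path_at_end x0 xE G_sym v_inj v_edge v_chordless x_max m mT
  D2 ltac:(lra) ml loss.
have [h h_bij h_sub] := kite_relabel G n D v (card_ord n) v_inj v_chordless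
  (fun i c iD cv => off i c iD (introT (off_pathP c) cv)) G_sym G_irr.
have GE := subgraph_eigenvalue G _ l k x (y \o h) i0 G_sym x0
  (fun a => yp (h a)) xE (eigenfun_relabel _ k y h h_bij yE) h_sub kl.
exists D.+1, m.+1; split=> //; first by rewrite addnS subn1.
apply: (iso_kite_on _ n); first by rewrite addnS subn1.
by exists h.
Qed.
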